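(* Let $(F,v)$ be a real valued field of characteristic $p>0$. Let $E$ be an extension of $F$ of degree $p^n$ such that $E^p\subseteq F$, viewed as a valued field via the unique extension of $v$. Let $S$ be a $p$-basis of $E$ over $F$ and let $T$ be its associated basis. Then \[ d(T)\ \ge\ (p-1)\sum_{i=1}^n \mathrm{ndist}_i(T,F). \]
   Context: A (real) valued field $(F,v)$ is a field $F$ with a function $v:F\to\mathbb{R}\cup\{\infty\}$ such that $v(x)=\infty$ iff $x=0$, $v(x+y)\ge\min\{v(x),v(y)\}$, and $v(xy)=v(x)+v(y)$. For a purely inseparable finite extension $E/F$, $v$ extends uniquely to $E$ (again denoted $v$). A $p$-basis of $E$ over $F$ (where $E^p\subseteq F$) is a subset $S\subseteq E$ such that the products $\prod_{s\in S}s^{e_s}$, with $e_s\in\{0,\dots,p-1\}$ and all but finitely many $e_s$ zero, are all distinct and form a basis $T$ of $E$ as an $F$-vector space; $T$ is called the associated basis of $S$. When $[E:F]=p^n$, $S$ has $n$ elements and $T$ has $p^n$ elements. Discrepancy: for an $F$-basis $T=\{\mathbf e_1,\dots,\mathbf e_m\}$ of $E$ and $0\neq\mathbf v=c_1\mathbf e_1+\cdots+c_m\mathbf e_m\in E$ with $c_i\in F$, put $d(T;\mathbf v)=v(\mathbf v)-\min_i\{v(c_i\mathbf e_i)\}\ge 0$, and $d(T)=\sup_{\mathbf v\ne0}d(T;\mathbf v)\in[0,\infty]$. Normalized distance: for $0\ne x\in E$, $\mathrm{ndist}(x,F)=\sup\{v(x-y)-v(x):y\in F\}\in[0,\infty]$.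 For $r\in\mathbb{R}$ put $U_r=\{t\in T:\mathrm{ndist}(t,F)\ge r\}$. For $i=1,\dots,n$, the $i$-th normalized distance from $T$ to $F$, $\mathrm{ndist}_i(T,F)\in[0,\infty]$, is the supremum of those $r\in\mathbb{R}$ for which $\#U_r\ge p^{\,n-i+1}$. *)

(* Defs.v *)
(* Valued fields and distances over MathComp-Analysis: R : realType plays the
   role of the real numbers and \bar R that of R U {-oo, +oo}. *)
From HB Require Import structures.
From mathcomp Require Import all_boot all_order all_algebra all_field.
From mathcomp Require Import finmap.
From mathcomp Require Import all_classical all_reals.
From mathcomp Require Import ereal.

Set Implicit Arguments.
Unset Strict Implicit.
Unset Printing Implicit Defensive.

Import Order.TTheory GRing.Theory Num.Theory.

Local Open Scope classical_set_scope.
Local Open Scope ring_scope.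
Local Open Scope ereal_scope.

(* [valuation_fin] says that the values lie in R U {+oo}. *)
Record is_valuation (R : realType) (K : fieldType) (v : K -> \bar R) : Prop := {
  valuation_fin : forall x, v x != -oo;
  valuation_eqy : forall x, v x = +oo <-> x = 0%R;
  valuation_add : forall x y, mine (v x) (v y) <= v (x + y)%R;
  valuation_mul : forall x y, v (x * y)%R = v x + v y
}.

(* F sits in E as the scalars y%:A, i.e. as the subspace 1%VS of E. *)
Definition extends_valuation (R : realType) (F : fieldType)
    (E : fieldExtType F) (v : F -> \bar R) (w : E -> \bar R) : Prop :=
  forall x : F, w (x%:A)%R = v x.

Section PBasis.
Variables (F : fieldType) (E : fieldExtType F).

(* S is an arbitrary subset of E; "all but finitely many e_s are zero" is built
   into {fsfun _ with 0}, and e vanishes outside S. *)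
Definition exponents (p : nat) (S : set E) : set {fsfun E -> nat with 0%N} :=
  [set e | (forall s, s \in finsupp e -> S s) /\ (forall s, (e s < p)%N)].

Definition monomial (e : {fsfun E -> nat with 0%N}) : E :=
  (\prod_(s <- finsupp e) s ^+ e s)%R.

Definition assoc_basis (p : nat) (S : set E) : set E :=
  monomial @` exponents p S.

(* E is finite-dimensional, so a basis is a finite set; [fset_set T] is T as a
   finite set, a junk value when T is infinite. *)
Definition is_basis (T : set E) : Prop :=
  finite_set T /\ basis_of fullv (fset_set T).

Definition is_pbasis (p : nat) (S : set E) : Prop :=
  set_inj (exponents p S) monomial /\ is_basis (assoc_basis p S).

End PBasis.

Section Distances.
Variables (R : realType) (F : fieldType) (E : fieldExtType F).
Variable w : E -> \bar R.

(* The min is taken over the coordinates c_i of x in the finite basis T. *)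
Definition discrepancy_at (T : set E) (x : E) : \bar R :=
  let X := in_tuple (fset_set T : seq E) in
  w x - \big[mine/+oo]_(i < size X) w (coord X i x *: X`_i)%R.

Definition discrepancy (T : set E) : \bar R :=
  ereal_sup [set discrepancy_at T x | x in [set x : E | x != 0%R]].

(* Meaningful for x != 0 only. *)
Definition ndist (x : E) : \bar R :=
  ereal_sup [set w (x - y%:A)%R - w x | y in [set: F]].

Definition ndist_ge (T : set E) (r : R) : set E :=
  [set t | T t /\ r%:E <= ndist t].

(* Meaningful for (1 <= i <= n)%N and T of cardinality p ^ n. *)
Definition ndist_nth (p n : nat) (T : set E) (i : nat) : \bar R :=
  ereal_sup [set r%:E | r in
    [set r : R | (p ^ (n - i + 1) <= #|` fset_set (ndist_ge T r)|)%N]].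

End Distances.

(* Main.v *)
(* Choose u_0, ..., u_(n-1) in T, each u_j with normalized distance close to
   ndist_(n-j) and outside the subfield generated by its predecessors; this is
   possible because that subfield has degree at most p^j. Take
   x = prod_j (u_j - y_j)^(p-1) with y_j in F nearly optimal for u_j. Expanding
   x gives monomials in the u_j, each an F-multiple of an element of T, and the
   choice of the u_j puts prod_j u_j^(p-1) on a line of its own. Hence it is a
   full T-component of x, so the discrepancy at x is at least
   (p-1) sum_j (v(u_j - y_j) - v(u_j)). *)
Require Import Defs.
From HB Require Import structures.
From mathcomp Require Import all_boot all_order all_algebra all_field.
From mathcomp Require Import finmap.
From mathcomp Require Import all_classical all_reals.
From mathcomp Require Import ereal.

Set Implicit Arguments.
Unset Strict Implicit.
Unset Printing Implicit Defensive.

Import Order.TTheory GRing.Theory Num.Theory.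

Local Open Scope classical_set_scope.
Local Open Scope ring_scope.
Local Open Scope ereal_scope.

(** * Subfields of E and sequences that are p-independent over F *)

Section FieldExtensions.
Local Open Scope ring_scope.
Variables (F : fieldType) (E : fieldExtType F).
Implicit Types (K : {subfield E}) (x : E) (u : seq E) (p : nat).

Lemma sub_free (A B : {fset E}) : (A `<=` B)%fset -> free B -> free A.
Proof.
move=> /fsubsetP AB /(filter_free (mem A)); rewrite (@perm_free _ _ _ A) //.
apply: uniq_perm; rewrite ?filter_uniq ?fset_uniq // => x.
by rewrite mem_filter andb_idr //; exact: AB.
Qed.

(** The minimal polynomial of [x] over [K] divides X^p - x^p. *)
Lemma adjoin_degree_le_exp K p x :
  (0 < p)%N -> x ^+ p \in K -> (adjoin_degree K x <= p)%N.
Proof.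
move=> p_gt0 xpK.
have size_q : size ('X^p - (x ^+ p)%:P : {poly E}) = p.+1 by rewrite size_XnsubC.
rewrite -ltnS -size_minPoly -size_q; apply: dvdp_leq.
  by rewrite -size_poly_eq0 size_q.
apply: minPoly_dvdp; first by rewrite rpredB ?rpredX ?polyOverX ?polyOverC.
by rewrite rootE !hornerE subrr.
Qed.

(** By Bezout, [b] and [p] being coprime, [x] is a power of [x ^+ b] divided by a power of
    [x ^+ p]. *)
Lemma mem_subfield_of_exp K p b x :
  prime p -> (0 < b < p)%N -> x ^+ p \in K -> x ^+ b \in K -> x \in K.
Proof.
move=> p_pr /andP[b_gt0 b_lt_p] xpK xbK.
have [->|x_neq0] := eqVneq x 0; first exact: mem0v.
case: (egcdnP p b_gt0) => km kn bezout _.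
have cop : gcdn b p = 1%N.
  by apply/eqP; rewrite -/(coprime b p) coprime_sym prime_coprime // gtnNdvd.
have -> : x = (x ^+ b) ^+ km / (x ^+ p) ^+ kn.
  rewrite -!exprM mulnC bezout cop addn1 exprS (mulnC p) mulfK //.
  by rewrite expf_eq0 (negPf x_neq0) andbF.
by apply: rpred_div; apply: rpredX.
Qed.

(** Sequential form of p-independence, suited to greedy construction and to induction on the last
    entry. *)
Definition pindependent u : Prop :=
  forall i, (i < size u)%N -> u`_i \notin <<1%AS & take i u>>%VS.

Lemma nth_neq0_of_pindependent u i :
  pindependent u -> (i < size u)%N -> u`_i != 0.
Proof.
by move=> ind /ind; apply: contraNneq => ->; exact: mem0v.
Qed.

(** Peel off the last factor: its power is a quotient of elements of the field generated by the
    earlier entries. A positive exponent below p would put the last entry itself in that field, so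
    the exponent is zero and induction applies. *)
Lemma exponents_eq0_of_pindependent p u (b : nat -> nat) m :
  prime p -> (forall x, x ^+ p \in 1%VS) -> pindependent u ->
  (m <= size u)%N -> (forall i, b i < p)%N ->
  \prod_(i < m) u`_i ^+ b i \in 1%VS -> forall i, (i < m)%N -> b i = 0%N.
Proof.
move=> p_pr hEp ind; elim: m => [//|m IHm] m_lt b_lt.
rewrite big_ord_recr /=; set P := \prod_(i < m) _ => PuK.
have sub1K : (1 <= <<1%AS & take m u>>)%VS by apply: sub1v.
have P_in : P \in <<1%AS & take m u>>%VS.
  apply: rpred_prod => i _; apply: rpredX; apply: seqv_sub_adjoin.
  rewrite -(nth_take _ (ltn_ord i)) mem_nth // size_takel // ltnW //.
have P_neq0 : P != 0.
  apply/prodf_neq0 => i _; rewrite expf_eq0 negb_and.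
  by rewrite (nth_neq0_of_pindependent ind) ?orbT ?(ltn_trans _ m_lt).
have bm0 : b m = 0%N.
  apply/eqP; rewrite -leqn0 leqNgt; apply/negP => bm_gt0.
  have /negP := ind m m_lt; apply.
  apply: (@mem_subfield_of_exp <<1%AS & take m u>>%AS p (b m)) => //.
  - by rewrite bm_gt0 b_lt.
  - exact: (subvP sub1K).
  - rewrite -(mulKf P_neq0 (_ ^+ _)) rpredM ?rpredV //.
    exact: (subvP sub1K).
move=> i; rewrite ltnS leq_eqVlt => /predU1P[->//|].
by apply: IHm => //; [exact: ltnW | rewrite bm0 expr0 mulr1 in PuK].
Qed.

(* Greedy choice: after [j] steps the chosen elements generate a subfield of
   degree at most [p ^ j], which cannot contain [p ^ j.+1] independent
   vectors. *)
Lemma exists_pindependent p n (U : nat -> seq E) :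
  prime p -> (forall x, x ^+ p \in 1%VS) ->
  (forall j, (j < n)%N -> free (U j)) ->
  (forall j, (j < n)%N -> (p ^ j.+1 <= size (U j))%N) ->
  exists u, [/\ size u = n, pindependent u &
    forall j, (j < n)%N -> u`_j \in U j].
Proof.
move=> p_pr hEp freeU sizeU.
suff: exists u, [/\ size u = n, pindependent u,
    forall j, (j < n)%N -> u`_j \in U j & (\dim <<1%AS & u>> <= p ^ n)%N].
  by move=> [u [? ? ? _]]; exists u.
elim: n freeU sizeU => [|n IHn] freeU sizeU.
  by exists [::]; split => //; rewrite Fadjoin_nil dimv1.
have [||u [size_u ind uU dim_u]] := IHn.
- by move=> j jn; apply: freeU; rewrite ltnW.
- by move=> j jn; apply: sizeU; rewrite ltnW.
have [x xU xK] : exists2 x, x \in U n & x \notin <<1%AS & u>>%VS.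
  apply/hasP; apply/negPn/negP => /hasPn subK.
  have : (size (U n) <= p ^ n)%N.
    rewrite -(eqP (freeU n _)) //; apply: leq_trans dim_u; apply: dimvS.
    by apply/span_subvP => x /subK /negPn.
  apply/negP; rewrite -ltnNge; apply: leq_trans (sizeU n _) => //.
  by rewrite ltn_exp2l // prime_gt1.
exists (rcons u x); split.
- by rewrite size_rcons size_u.
- move=> i; rewrite size_rcons ltnS leq_eqVlt => /predU1P[->|i_lt].
    by rewrite nth_rcons ltnn eqxx -cats1 take_size_cat.
  by rewrite nth_rcons i_lt -cats1 take_cat i_lt ind.
- move=> j; rewrite ltnS leq_eqVlt => /predU1P[->|jn].
    by rewrite nth_rcons size_u ltnn eqxx.
  by rewrite nth_rcons size_u jn uU.
- rewrite adjoin_rcons dim_Fadjoin expnS leq_mul //.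
  apply: adjoin_degree_le_exp; first exact: prime_gt0.
  by apply: (subvP (sub1v _)).
Qed.

End FieldExtensions.

(** * Scalar multiples of elements of the associated basis, a set closed under products *)

Section Homogeneous.
Local Open Scope ring_scope.
Variables (F : fieldType) (E : fieldExtType F) (p : nat) (S : set E).
Hypothesis p_gt0 : (0 < p)%N.
Hypothesis hEp : forall x : E, x ^+ p \in 1%VS.

Definition homogeneous (x : E) : Prop :=
  exists c : F, exists2 t, assoc_basis p S t & x = c *: t.

Lemma monomialE (e : {fsfun E -> nat with 0%N}) (A : {fset E}) :
  (finsupp e `<=` A)%fset -> monomial e = \prod_(s <- A) s ^+ e s.
Proof.
move=> sub; rewrite /monomial; apply: (big_fset_incl _ sub) => s _ snot.
by rewrite (fsfun_dflt snot) expr0.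
Qed.

(** Divide each exponent by p with remainder: the remainders give an element of the basis, and the
    remaining factor is a product of p-th powers, hence a scalar. *)
Lemma homogeneous_prod_exp (A : {fset E}) (g : E -> nat) :
  (forall s, s \in A -> S s) -> homogeneous (\prod_(s <- A) s ^+ g s).
Proof.
move=> AS.
pose e : {fsfun E -> nat with 0%N} := [fsfun s in A => (g s %% p)%N].
have eE s : e s = if s \in A then (g s %% p)%N else 0%N by rewrite fsfun_fun.
have suppA : (finsupp e `<=` A)%fset.
  by apply/fsubsetP => s; rewrite mem_finsupp eE; case: ifP => //; rewrite eqxx.
have /vlineP[c cE] : \prod_(s <- A) (s ^+ p) ^+ (g s %/ p) \in 1%VS.
  by apply: rpred_prod => s _; rewrite rpredX.
exists c; exists (monomial e).
  exists e => //; split; first by move=> s /(fsubsetP suppA) /AS.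
  by move=> s; rewrite eE; case: ifP => // _; rewrite ltn_mod.
rewrite (monomialE suppA) -mulr_algl -cE -big_split /=.
apply: eq_big_seq => s sA.
by rewrite eE sA -exprM -exprD mulnC -divn_eq.
Qed.

Lemma homogeneous_basis t : assoc_basis p S t -> homogeneous t.
Proof. by move=> tT; exists 1; exists t; rewrite ?scale1r. Qed.

Lemma homogeneous1 : homogeneous 1.
Proof.
by have := @homogeneous_prod_exp fset0 (fun=> 0%N); rewrite big_seq_fset0; apply.
Qed.

Lemma homogeneousM x y : homogeneous x -> homogeneous y -> homogeneous (x * y).
Proof.
move=> [c [_ [e [eS _] <-] ->]] [d [_ [f [fS _] <-] ->]].
pose A := (finsupp e `|` finsupp f)%fset.
have [|a [t tT tE]] := @homogeneous_prod_exp A (fun s => e s + f s)%N.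
  by move=> s; rewrite in_fsetU => /orP[/eS|/fS].
exists (c * d * a); exists t => //.
rewrite -scalerA -tE -scalerAl -scalerAr scalerA.
rewrite (monomialE (fsubsetUl _ _ : (finsupp e `<=` A)%fset)).
rewrite (monomialE (fsubsetUr _ _ : (finsupp f `<=` A)%fset)).
by rewrite -big_split /=; congr (_ *: _); apply: eq_bigr => s _; rewrite exprD.
Qed.

Lemma homogeneousX x k : homogeneous x -> homogeneous (x ^+ k).
Proof.
move=> hx; elim: k => [|k IHk]; first exact: homogeneous1.
by rewrite exprS; apply: homogeneousM.
Qed.

Lemma homogeneous_prod (I : Type) (r : seq I) (f : I -> E) :
  (forall i, homogeneous (f i)) -> homogeneous (\prod_(i <- r) f i).
Proof.
move=> hf; elim: r => [|i r IHr]; first by rewrite big_nil; apply: homogeneous1.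
by rewrite big_cons; apply: homogeneousM.
Qed.

End Homogeneous.

(** * Valuations of powers and products, and bounds on extended real sums *)

Section Valuations.
Variables (R : realType) (K : fieldType) (w : K -> \bar R).
Hypothesis hw : is_valuation w.

Lemma valuation_fin_num x : x != 0%R -> w x \is a fin_num.
Proof.
move=> x_neq0; rewrite fin_numE (valuation_fin hw) /=.
by apply: contraNneq x_neq0 => /(valuation_eqy hw) ->.
Qed.

Lemma valuation1 : w 1%R = 0.
Proof.
have w1 := valuation_fin_num (oner_neq0 K).
have := valuation_mul hw 1%R 1%R; rewrite mulr1 -(fineK w1) -EFinD => -[].
by move/eqP; rewrite -subr_eq subrr => /eqP <-.
Qed.

Lemma valuation_exp x k : x != 0%R -> w (x ^+ k)%R = (fine (w x) *+ k)%:E.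
Proof.
move=> x_neq0; elim: k => [|k IHk]; first by rewrite expr0 valuation1.
by rewrite exprS (valuation_mul hw) IHk mulrS EFinD fineK // valuation_fin_num.
Qed.

Lemma valuation_prod_exp n (f : nat -> K) k : (forall i, (i < n)%N -> f i != 0%R) ->
  w (\prod_(i < n) f i ^+ k)%R = (k%:R * \sum_(i < n) fine (w (f i)))%:E.
Proof.
elim: n => [|n IHn] f_neq0; first by rewrite !big_ord0 mulr0 valuation1.
rewrite !big_ord_recr /= (valuation_mul hw) IHn; last first.
  by move=> i /ltnW; apply: f_neq0.
by rewrite valuation_exp ?f_neq0 // mulrDr EFinD mulr_natl (mulr_natl (fine _)).
Qed.

End Valuations.

(** Normalized distances can be infinite or not attained; this reduces a bound on their sum to real
    numbers strictly below each term. *)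
Lemma sum_le_of_lt (R : realType) n (a : 'I_n -> \bar R) (D : \bar R) :
  (forall i, a i != -oo) ->
  (forall r : 'I_n -> R, (forall i, (r i)%:E < a i) ->
    (\sum_(i < n) r i)%:E <= D) ->
  \sum_(i < n) a i <= D.
Proof.
move=> aNy hD.
have lt_a i (e : R) : (0 < e)%R -> (fine (a i) - e)%:E < a i.
  move=> e_gt0; have := aNy i.
  by case: (a i) => [s||] //= _; [rewrite lte_fin gtrBl | rewrite ltry].
have [[i ai]|no_y] := pselect (exists i, a i = +oo).
  suff -> : D = +oo by rewrite leey.
  apply/eqyP => A A_gt0.
  (* The infinite term has no upper constraint, so its approximation can absorb the others and make
     the total any prescribed [A]. *)
  pose q j := (fine (a j) - 1)%R.
  pose r j := (if j == i then A - \sum_(j | j != i) q j else q j)%R.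
  suff <- : (\sum_(j < n) r j = A)%R.
    apply: hD => j; rewrite /r; case: eqP => [->|_]; first by rewrite ai ltry.
    exact: lt_a.
  rewrite (bigD1 i) //= {1}/r eqxx [X in (_ + X)%R](eq_bigr q) ?subrK //.
  by move=> j /negPf jNi; rewrite /r jNi.
have a_fin i : a i \is a fin_num.
  by rewrite fin_numE aNy; apply/eqP => ai; apply: no_y; exists i.
apply/lee_addgt0Pr => e e_gt0.
(* Each term gives up [e / n.+1], for a total loss of at most [e]; the successor avoids dividing by
   zero when [n] is 0. *)
have n_gt0 : (0 < n.+1%:R :> R)%R by rewrite ltr0n.
have := hD (fun i => fine (a i) - e / n.+1%:R)%R.
move=> /(_ (fun i => lt_a i _ (divr_gt0 e_gt0 n_gt0))).
rewrite sumrB sumr_const card_ord EFinB leeBlDr // => le_D.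
rewrite (eq_bigr (fun i => (fine (a i))%:E)) => [|i _]; last by rewrite fineK.
rewrite sumEFin; apply: le_trans le_D _; apply: leeD => //.
rewrite lee_fin -[leLHS]mulr_natr -mulrA ler_piMr ?(ltW e_gt0) // mulrC.
by rewrite ler_pdivrMr // mul1r ler_nat.
Qed.

(** * The lower bound on the discrepancy given by one p-independent sequence in T *)

Section Discrepancy.
Variables (R : realType) (F : fieldType) (E : fieldExtType F) (p : nat).
Variables (w : E -> \bar R) (S : set E) (u : seq E).
Hypothesis p_pr : prime p.
Hypothesis hEp : forall x : E, (x ^+ p)%R \in 1%VS.
Hypothesis hw : is_valuation w.
Hypothesis hT : is_basis (assoc_basis p S).
Hypothesis ind : pindependent u.
Hypothesis uT : forall i, (i < size u)%N -> assoc_basis p S (u`_i)%R.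

Let T := assoc_basis p S.
Let X := in_tuple (fset_set T : seq E).

Lemma free_basis_tuple : free X.
Proof. by have [_ /basis_free] := hT. Qed.

Lemma mem_basisP t : T t -> exists k : 'I_(size X), t = (X`_k)%R.
Proof.
move=> tT; have tX : t \in (fset_set T : seq E).
  by have [finT _] := hT; rewrite in_fset_set // inE.
have lt_k : (index t (fset_set T) < size X)%N by rewrite index_mem.
by exists (Ordinal lt_k); rewrite /= nth_index.
Qed.

Let q := (p - 1)%N.
Let top := (\prod_(i < size u) u`_i ^+ q)%R.

Lemma coord_prod_exp_eq0 (k : 'I_(size X)) c (f : 'I_(size u) -> nat) :
  top = (c *: X`_k)%R -> (forall i, (f i <= q)%N) -> (exists i, f i != 0%N) ->
  coord X k (\prod_(i < size u) u`_i ^+ (q - f i))%R = 0%R.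
Proof.
move=> topE f_le [i0 fi0].
have p_gt0 := prime_gt0 p_pr.
have [a [t tT aE]] : homogeneous p S (\prod_(i < size u) u`_i ^+ (q - f i))%R.
  apply: homogeneous_prod => // i; apply: homogeneousX => //.
  exact/homogeneous_basis/uT.
have [j tE] := mem_basisP tT.
rewrite aE tE linearZ /= (coord_free _ _ free_basis_tuple).
have [jk|] := eqVneq j k; last by rewrite mulr0.
case/eqP: fi0.
(* [g] extends [f] by zero to all naturals, as the independence lemma expects. *)
pose g i := if insub i is Some i' then f i' else 0%N.
have gE (i : 'I_(size u)) : g i = f i by rewrite /g valK.
rewrite -gE.
apply: (exponents_eq0_of_pindependent p_pr hEp ind (leqnn _)) (ltn_ord i0).
  move=> i; rewrite /g; case: insubP => [i' _ _|//].
  by rewrite (leq_ltn_trans (f_le i')) // /q subn1 prednK.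
have top_neq0 : top != 0%R.
  apply/prodf_neq0 => i _; rewrite expf_eq0 negb_and.
  by rewrite (nth_neq0_of_pindependent ind) ?orbT.
have topM : top = (a *: t * \prod_(i < size u) u`_i ^+ g i)%R.
  rewrite -aE -big_split /=; apply: eq_bigr => i _.
  by rewrite gE -exprD subnK.
have at_neq0 : (a *: t != 0)%R.
  by apply: contraNneq top_neq0 => at0; rewrite topM at0 mul0r.
have [a_neq0 t_neq0] : a != 0%R /\ t != 0%R.
  by apply/andP; rewrite -negb_or -scaler_eq0.
rewrite -(mulKf at_neq0 (\prod_(i < size u) u`_i ^+ g i)%R) -topM topE -jk -tE.
apply/vlineP; exists (a^-1 * c)%R.
by rewrite invrZ ?unitfE // -scalerAl -scalerAr mulVf // scalerA.
Qed.

(** In the binomial expansion, the choice of exponent 0 of [y] in every factor yields [top]; every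
    other choice yields a term without coordinate at [k]. *)
Lemma coord_prod_sub (k : 'I_(size X)) c (y : nat -> F) : top = (c *: X`_k)%R ->
  coord X k (\prod_(i < size u) (u`_i - (y i)%:A) ^+ q)%R = c.
Proof.
move=> topE.
pose G (i : 'I_(size u)) (j : 'I_q.+1) : E :=
  (u`_i ^+ (q - j) * (- (y i)%:A) ^+ j *+ 'C(q, j))%R.
rewrite (eq_bigr (fun i => \sum_j G i j)%R); last by move=> i _; rewrite exprDn.
rewrite bigA_distr_bigA /= (bigD1 [ffun=> ord0]) //= [X in coord _ _ (X + _)](_ : _ = top).
  rewrite linearD topE linearZ /= (coord_free _ _ free_basis_tuple) eqxx mulr1.
  rewrite linear_sum big1 ?addr0 // => f f_neq0.
  pose d (i : 'I_(size u)) := ((- y i) ^+ f i *+ 'C(q, f i))%R.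
  have -> : (\prod_i G i (f i))%R =
      ((\prod_i d i) *: \prod_(i < size u) u`_i ^+ (q - f i))%R.
    rewrite -GRing.scaler_prod; apply: eq_bigr => i _.
    rewrite /G /d -in_algE -rmorphN -rmorphXn -mulrnAr -rmorphMn /=.
    by rewrite mulrC mulr_algl.
  rewrite linearZ /= (coord_prod_exp_eq0 topE) ?mulr0 //.
    by move=> i; rewrite -ltnS.
  apply/existsP; apply: contraNT f_neq0; rewrite negb_exists => /forallP f0.
  by apply/eqP/ffunP => i; apply/val_inj; rewrite ffunE; apply/eqP/negPn/f0.
by apply: eq_bigr => i _; rewrite ffunE /G subn0 expr0 mulr1 bin0 mulr1n.
Qed.

Lemma discrepancy_ge (y : nat -> F) :
  (q%:R * \sum_(i < size u)
    (fine (w (u`_i - (y i)%:A)%R) - fine (w u`_i)))%:E <= discrepancy w T.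
Proof.
have p_gt0 := prime_gt0 p_pr.
pose x := (\prod_(i < size u) (u`_i - (y i)%:A) ^+ q)%R.
have u_neq0 i : (i < size u)%N -> (u`_i != 0)%R.
  exact: nth_neq0_of_pindependent.
have uy_neq0 i : (i < size u)%N -> (u`_i - (y i)%:A != 0)%R.
  move=> /ind; apply: contraNneq => /eqP; rewrite subr_eq0 => /eqP ->.
  by rewrite rpredZ // rpred1.
have x_neq0 : (x != 0)%R.
  by apply/prodf_neq0 => i _; rewrite expf_eq0 negb_and uy_neq0 ?orbT.
apply: (@le_trans _ _ (discrepancy_at w T x)); last first.
  by apply: ereal_sup_ubound; exists x.
have [c [t tT]] : homogeneous p S top.
  apply: homogeneous_prod => // i; apply: homogeneousX => //.
  exact/homogeneous_basis/uT.
have [k ->] := mem_basisP tT; move=> topE.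
rewrite /discrepancy_at sumrB mulrBr EFinB.
rewrite -(valuation_prod_exp hw _ uy_neq0) -(valuation_prod_exp hw _ u_neq0).
(* The minimum is at most its entry at [k], which is the value of [top]. *)
apply: leeB => //; apply: le_trans (bigmin_le _ k _) _.
by rewrite /x (coord_prod_sub _ topE) -topE.
Qed.

End Discrepancy.

(** * Choice of the sequence and of near-optimal approximations *)

Theorem proposition6p4 (R : realType) (F : fieldType) (p : nat)
    (hp : p \in [pchar F]%R)
    (v : F -> \bar R) (hv : is_valuation v)
    (E : fieldExtType F) (n : nat) (hdim : \dim {:E} = (p ^ n)%N)
    (hEp : forall x : E, (x ^+ p)%R \in 1%VS)
    (w : E -> \bar R) (hw : is_valuation w) (hwv : extends_valuation v w)
    (S : set E) (hS : is_pbasis p S) :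
  ((p - 1)%N%:R)%:E * \sum_(1 <= i < n.+1) ndist_nth w p n (assoc_basis p S) i
    <= discrepancy w (assoc_basis p S).
Proof.
have p_pr := pcharf_prime hp.
have [_ hT] := hS; have [finT basisT] := hT.
set T := assoc_basis p S in hT finT basisT *.
have T_neq0 t : T t -> t != 0%R.
  have /free_not0 := basis_free basisT.
  by move=> T0 tT; apply: T0; rewrite in_fset_set // inE.
have finU r : finite_set (ndist_ge w T r).
  by apply: sub_finite_set finT => t [].
have subU r : (fset_set (ndist_ge w T r) `<=` fset_set T)%fset.
  by rewrite -fset_set_sub // => t [].
have ndist_ge0 t : T t -> 0 <= ndist w t.
  move=> tT; apply: ereal_sup_ubound; exists 0%R => //.
  by rewrite scale0r subr0 subee // valuation_fin_num // T_neq0.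
(* The threshold 0 is admissible: it selects all of T, which has p^n elements, at least p^(n-i+1)
   since i is positive. *)
have ndist_nth_ge0 i : (0 < i <= n)%N -> 0 <= ndist_nth w p n T i.
  move=> /andP[i_gt0 i_le]; apply: ereal_sup_ubound; exists 0%R => //=.
  have -> : ndist_ge w T 0 = T.
    by apply/seteqP; split => t; [case | move=> tT; split; rewrite ?ndist_ge0].
  have -> : #|` fset_set T| = (p ^ n)%N.
    by rewrite -hdim -(span_basis basisT) (eqP (basis_free basisT)).
  rewrite leq_exp2l ?prime_gt1 //.
  by rewrite addn1 ltn_subrL i_gt0 (leq_trans i_gt0).
(* The index is reversed so that term [i] asks for p^(i+1) elements, the size required by step [i]
   of the greedy choice. *)
pose a (i : 'I_n) := ((p - 1)%N%:R)%:E * ndist_nth w p n T (n - i).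
have -> : ((p - 1)%N%:R)%:E * \sum_(1 <= i < n.+1) ndist_nth w p n T i
    = \sum_(i < n) a i.
  rewrite big_nat_rev big_add1 big_mkord ge0_sume_distrr // => i _.
  rewrite add1n subSS; apply: ndist_nth_ge0.
  by apply/andP; split; [rewrite subn_gt0; exact: ltn_ord | exact: leq_subr].
have q_gt0 : (0 < (p - 1)%N%:R :> R)%R by rewrite ltr0n subn_gt0 prime_gt1.
apply: sum_le_of_lt => [i|r r_lt].
  suff : 0 <= a i by apply: contraTneq => ->.
  apply: mule_ge0; first by rewrite lee_fin ltW.
  by rewrite ndist_nth_ge0 // subn_gt0 ltn_ord leq_subr.
(* Removing the factor p-1 turns [r i] into a real strictly below the normalized distance; 0 is a
   filler beyond [n]. *)
pose r' i := if insub i is Some i' then (r i' / (p - 1)%N%:R)%R else 0%R.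
have r'_lt i : (i < n)%N -> (r' i)%:E < ndist_nth w p n T (n - i).
  move=> i_lt; rewrite /r' insubT /= mulrC EFinM.
  by rewrite lte_pdivrMl.
have /choice[U hU] : forall i, exists U : seq E, (i < n)%N ->
    [/\ free U, (p ^ i.+1 <= size U)%N &
        forall t, t \in U -> T t /\ (r' i)%:E < ndist w t].
  move=> i; have [i_lt|] := boolP (i < n)%N; last by exists [::].
  (* Some admissible threshold [s] exceeds [r' i], so every element it selects has normalized
     distance above [r' i]. *)
  have [_ [s hs <-] r'_lt_s] := ereal_sup_gt (r'_lt i i_lt).
  exists (fset_set (ndist_ge w T s)) => _; split.
  - exact: sub_free (subU s) (basis_free basisT).
  - by move: hs; rewrite /= subKn ?addn1 // ltnW.
  - move=> t; rewrite in_fset_set // inE => -[tT s_le]; split=> //.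
    exact: lt_le_trans s_le.
have [||u [size_u ind uU]] := @exists_pindependent _ E p n U p_pr hEp.
- by move=> j /hU[].
- by move=> j /hU[].
have uT i : (i < size u)%N -> T (u`_i)%R.
  by rewrite size_u => i_lt; have [_ _ h] := hU i i_lt; have [] := h _ (uU i i_lt).
have /choice[y hy] : forall i, exists y : F, (i < size u)%N ->
    (r' i <= fine (w (u`_i - y%:A)%R) - fine (w u`_i))%R.
  move=> i; have [i_lt|] := boolP (i < size u)%N; last by exists 0%R.
  have i_lt_n : (i < n)%N by rewrite -size_u.
  have [_ _ h] := hU i i_lt_n; have [_] := h _ (uU i i_lt_n).
  (* The supremum defining [ndist] exceeds [r' i], so some scalar [y] already does better. *)
  move=> /ereal_sup_gt[_ [y _ <-] lt_y]; exists y => _.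
  rewrite -lee_fin EFinB !fineK ?ltW // valuation_fin_num //.
    exact: nth_neq0_of_pindependent i_lt.
  have := ind i i_lt; apply: contraNneq => /eqP; rewrite subr_eq0 => /eqP ->.
  by rewrite rpredZ // rpred1.
apply: le_trans (discrepancy_ge p_pr hEp hw hT ind uT y).
rewrite lee_fin size_u mulr_sumr; apply: ler_sum => i _.
apply: le_trans (ler_wpM2l (ltW q_gt0) (hy i _)); last by rewrite size_u.
by rewrite /r' valK mulrCA divff ?mulr1 // gt_eqF.
Qed.
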